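(* Let $1\le n\le N$ and $i,j\in\{1,\dots,r_n\}$. Define the polynomial $$\Phi^n_{ij}(y)=\frac12\int_{-1}^1\Psi_{nj}\bigl(\tfrac12(1-y)(1+z)-1\bigr)\,\Psi'_{ni}\bigl(1-\tfrac12(1-y)(1-z)\bigr)\,dz .$$ Then $$H^{n0}_{ij}=\frac{(k_n/2)^\alpha}{\Gamma(\alpha)}\biggl(\Psi_{ni}(1)\int_{-1}^1(1-\sigma)^{\alpha-1}\Psi_{nj}(\sigma)\,d\sigma-\int_{-1}^1(1+y)^{\alpha-1}(1-y)\Phi^n_{ij}(y)\,dy\biggr).$$
   Context: Fix $0<\alpha<1$ and set $\omega_\alpha(t)=t^{\alpha-1}/\Gamma(\alpha)$ for $t>0$. Let $0=t_0<t_1<\cdots<t_N=T$ be a grid, $k_n=t_n-t_{n-1}$ and $I_n=(t_{n-1},t_n)$. For integers $r_1,\dots,r_N\ge1$ and each $1\le n\le N$, let $\psi_{n1},\dots,\psi_{nr_n}$ be a basis of $\mathbb{P}_{r_n-1}$, the space of real polynomials of degree at most $r_n-1$. Define the affine map $\mathsf{t}_n:[-1,1]\to[t_{n-1},t_n]$ by $\mathsf{t}_n(\tau)=\tfrac12[(1-\tau)t_{n-1}+(1+\tau)t_n]$ and set $\Psi_{nj}(\tau)=\psi_{nj}(\mathsf{t}_n(\tau))$ for $-1\le\tau\le1$ (extended as a polynomial). For $t\in I_n$ define $$\rho^{n0}_j(t)=\int_{t_{n-1}}^t\omega_\alpha(t-s)\psi_{nj}(s)\,ds,\qquad\text{and}\qquad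 H^{n0}_{ij}=\int_{I_n}(\rho^{n0}_j)'(t)\,\psi_{ni}(t)\,dt .$$ *)

(* Defs.v *)
From mathcomp Require Import all_boot all_order all_algebra.
From mathcomp Require Import all_classical all_reals all_analysis.

Set Implicit Arguments.
Unset Strict Implicit.
Unset Printing Implicit Defensive.

Import Order.TTheory GRing.Theory Num.Theory.
Import numFieldNormedType.Exports.

Local Open Scope classical_set_scope.
Local Open Scope ring_scope.

(* All integrals are Lebesgue integrals, taken
   over open intervals so that the integrands are never evaluated at the
   singular endpoints of the weakly singular kernel (where [powR] is total by
   convention). *)

Definition Gamma (R : realType) (a : R) : R :=
  \int[lebesgue_measure]_(x in `]0, +oo[) (x `^ (a - 1) * expR (- x)).

Definition omega (R : realType) (alpha x : R) : R :=
  x `^ (alpha - 1) / Gamma alpha.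

(* Only the nodes [t 0], ..., [t N] are meaningful. *)
Definition is_grid (R : realType) (N : nat) (T : R) (t : nat -> R) : Prop :=
  [/\ t 0%N = 0, t N = T & forall m, (m < N)%N -> t m < t m.+1].

Definition step (R : realType) (t : nat -> R) (n : nat) : R := t n - t n.-1.

Definition ref_map (R : realType) (t : nat -> R) (n : nat) : {poly R} :=
  2^-1 *: ((1 - 'X) * (t n.-1)%:P + (1 + 'X) * (t n)%:P).

Definition pullback (R : realType) (t : nat -> R) (n : nat) (p : {poly R}) :
  {poly R} := p \Po ref_map t n.

Definition rho0 (R : realType) (alpha : R) (t : nat -> R) (n : nat)
    (p : {poly R}) (x : R) : R :=
  \int[lebesgue_measure]_(s in `]t n.-1, x[) (omega alpha (x - s) * p.[s]).

(* [H0 alpha t n p q] is the entry with column function [p] and row function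
   [q]. *)
Definition H0 (R : realType) (alpha : R) (t : nat -> R) (n : nat)
    (p q : {poly R}) : R :=
  \int[lebesgue_measure]_(x in `]t n.-1, t n[)
     ((rho0 alpha t n p)^`()%classic x * q.[x]).

(* Here [P] and [Q] stand for the pulled-back basis polynomials with indices
   [j] and [i] respectively. *)
Definition Phi (R : realType) (P Q : {poly R}) (y : R) : R :=
  2^-1 * \int[lebesgue_measure]_(z in `]-1, 1[)
     (P.[2^-1 * (1 - y) * (1 + z) - 1]
      * (Q^`()).[1 - 2^-1 * (1 - y) * (1 - z)]).

(* Main.v *)
Require Import Defs.
From HB Require Import structures.
From mathcomp Require Import all_boot all_order all_algebra ring lra.
From mathcomp Require Import all_classical all_reals all_analysis.
From mathcomp Require Import measurable_realfun.
Import Order.TTheory GRing.Theory Num.Theory.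
Import numFieldNormedType.Exports.
Local Open Scope classical_set_scope.
Local Open Scope ring_scope.

(** Rescale the interval [a, a + h] to [0, 1], let p and q be the column and row
functions in the variable u of [0, 1], and write L f for the integral of
u^(alpha - 1) f(u) over [0, 1].  The proof has two layers.

Analytically, every integral in the statement is the integral of a polynomial
against a power of the distance to one endpoint, so it is a value of L up to
the scaling factor h^alpha.  This rests on two facts: the improper fundamental
theorem of calculus for nonnegative integrands ([ge0_FTC2_oo]), which gives the
integrals of the powers themselves, and linearity ([Rintegral_powR_poly]).  The
function [rho0] is then (x - a)^alpha times a polynomial G in (x - a)/h, where
G(u) = L(p(u(1 - X))) ([rho0E]); it can be differentiated explicitly, and the
entry becomes h^alpha / Gamma(alpha) * L((alpha G + X G') q) ([H0E]).

Algebraically, u^(alpha - 1) (alpha G + u G') is the derivative of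
u^alpha G(u), so integration by parts yields G(1) q(1) - L(X G q')
([beta_moment_by_parts]).  The first term is the first integral of the
statement.  The second is a double integral over the triangle 0 < v < y < 1 of
v^(alpha - 1) p(y - v) q'(y); integrating in y first gives L(K), where
K(v) is the integral of p(y - v) q'(y) over [v, 1] ([beta_moment_xcorr]), and
the substitution y = v + (1 - v) w turns K(v) into (1 - y) Phi(y) at the
reference point y = 2 v - 1 ([PhiE], [xcorr_polyE]).

All functions being polynomial, L is defined on coefficients by
u^m |-> 1 / (alpha + m).  Integration by parts and the exchange of the order
of integration are then identities between fractions attached to
monomials, and no theorem on double integrals is involved. *)

(** * Moments of polynomials against a power weight *)

Section BetaMoment.
Context {R : realType}.
Implicit Types (b v : R) (f g p q : {poly R}).

(** For b > 0 this is the integral of u^(b - 1) f(u) over [0, 1]; in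
particular [beta_moment 1] is the plain integral. *)
Definition beta_moment b f : R := \sum_(m < size f) f`_m / (b + m%:R).

Lemma beta_moment_widen b f n : (size f <= n)%N ->
  beta_moment b f = \sum_(m < n) f`_m / (b + m%:R).
Proof.
move=> le_fn; rewrite /beta_moment (big_ord_widen _ (fun m => f`_m / (b + m%:R)) le_fn).
rewrite big_mkcond; apply: eq_bigr => m _.
by case: ltnP => // /(nth_default 0) ->; rewrite mul0r.
Qed.

Lemma beta_moment_is_linear b : linear_for *%R (beta_moment b).
Proof.
move=> c f g /=; pose n := maxn (size (c *: f + g)) (maxn (size f) (size g)).
rewrite !(@beta_moment_widen b _ n) ?leq_max ?leqnn ?orbT//.
rewrite mulr_sumr -big_split; apply: eq_bigr => m _.
by rewrite coefD coefZ /= mulrDl mulrA.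
Qed.

HB.instance Definition _ b := GRing.isLinear.Build R {poly R} R _
  (beta_moment b) (beta_moment_is_linear b).

Lemma beta_momentZ b c f : beta_moment b (c *: f) = c * beta_moment b f.
Proof. exact: linearZ. Qed.

Lemma beta_momentB b f g :
  beta_moment b (f - g) = beta_moment b f - beta_moment b g.
Proof. exact: raddfB. Qed.

Lemma beta_momentMn b f n : beta_moment b (f *+ n) = beta_moment b f *+ n.
Proof. exact: raddfMn. Qed.

Lemma beta_moment_sum b (I : Type) (r : seq I) (P : pred I) (F : I -> {poly R}) :
  beta_moment b (\sum_(i <- r | P i) F i) =
  \sum_(i <- r | P i) beta_moment b (F i).
Proof. exact: raddf_sum. Qed.

Lemma beta_momentXn b n : beta_moment b 'X^n = (b + n%:R)^-1.
Proof.
rewrite (@beta_moment_widen _ _ n.+1) ?size_polyXn// big_ord_recr big1 /=.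
  by rewrite add0r coefXn eqxx mul1r.
by move=> m _; rewrite coefXn ltn_eqF ?mul0r.
Qed.

Lemma poly_sumXn f : f = \sum_(m < size f) f`_m *: 'X^m.
Proof. by rewrite -poly_def coefK. Qed.

Lemma beta_moment_deriv1 f : beta_moment 1 f^`() = f.[1] - f.[0].
Proof.
rewrite [f]poly_sumXn (raddf_sum (@deriv R)) beta_moment_sum /= !horner_sum -sumrB.
apply: eq_bigr => -[[|m] _] _ /=; rewrite derivZ derivXn.
  by rewrite mulr0n scaler0 raddf0 !hornerE subrr.
rewrite beta_momentZ beta_momentMn beta_momentXn !hornerE/= expr1n expr0n/=.
by rewrite mulr0 subr0 -[_ *+ _]mulr_natr -nat1r mulVf ?nat1r ?pnatr_eq0.
Qed.

(** The weighted integrand u^(b - 1) (b f + u f') is the derivative of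
u^b f(u), which vanishes at 0. *)
Lemma beta_moment_euler b f : 0 < b ->
  beta_moment b (b *: f + 'X * f^`()) = f.[1].
Proof.
move=> b0; rewrite {1 2}[f]poly_sumXn.
rewrite scaler_sumr (raddf_sum (@deriv R)) /= mulr_sumr -big_split.
rewrite beta_moment_sum /= horner_coef.
apply: eq_bigr => -[m _] _ /=; rewrite derivZ derivXn.
rewrite scalerA -scalerAr mulrnAr -exprS.
have -> : 'X^(m.-1.+1) *+ m = (m%:R : R) *: 'X^m :> {poly R}.
  by case: m => [|m]; rewrite ?mulr0n ?scale0r// scaler_nat.
rewrite scalerA -scalerDl beta_momentZ beta_momentXn expr1n mulr1 mulrC.
have : b + m%:R != 0 by rewrite gt_eqF// ltr_wpDr.
by move=> ?; field.
Qed.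

(** The Abel integral of s^(b - 1) p(y - s) over [0, y] is y^b times this
polynomial at y (see [abel_polyE]). *)
Definition abel_poly b p : {poly R} :=
  \sum_(k < size p) (p`_k * beta_moment b ((1 - 'X) ^+ k)) *: 'X^k.

Lemma abel_polyE b p y :
  (abel_poly b p).[y] = beta_moment b (p \Po (y *: (1 - 'X))).
Proof.
rewrite comp_polyE horner_sum beta_moment_sum; apply: eq_bigr => k _ /=.
by rewrite exprZn !beta_momentZ hornerZ hornerXn mulrA mulrAC -mulrA.
Qed.

(** The integral of (y - v)^k y^l over y in [v, 1], as a polynomial in v: expand
the binomial and integrate term by term. *)
Definition xcorr_monom (k l : nat) : {poly R} :=
  \sum_(i < k.+1) ('C(k, i)%:R * (- 1) ^+ (k - i) / (i + l).+1%:R) *: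
     ('X^(k - i) - 'X^((k + l).+1)).

(** The truncated cross-correlation, the integral of p(y - v) g(y) over y in
[v, 1], as a polynomial in v (see [xcorr_polyE]). *)
Definition xcorr_poly p g : {poly R} :=
  \sum_(k < size p) \sum_(l < size g) (p`_k * g`_l) *: xcorr_monom k l.

(** The integral of y^n over [v, 1], computed with y = v + (1 - v) u. *)
Lemma beta_moment1_affineXn v n :
  (1 - v) * beta_moment 1 ((v%:P + (1 - v) *: 'X) ^+ n) =
  (1 - v ^+ n.+1) / n.+1%:R.
Proof.
have := beta_moment_deriv1 ((v%:P + (1 - v) *: 'X) ^+ n.+1).
rewrite deriv_exp !poly.derivE add0r /= -?scalerAl.
rewrite beta_momentMn beta_momentZ mul1r !hornerE /= addrAC subrr add0r expr1n => <-.
by rewrite -[_ * _ *+ _]mulr_natr mulfK // pnatr_eq0.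
Qed.

(** The right-hand side is the integral of p(y - v) g(y) over y in [v, 1] after
the substitution y = v + (1 - v) w with w in [0, 1]. *)
Lemma xcorr_polyE p g v :
  (xcorr_poly p g).[v] = (1 - v) *
    beta_moment 1 ((p \Po ((1 - v) *: 'X)) * (g \Po (v%:P + (1 - v) *: 'X))).
Proof.
rewrite !comp_polyE mulr_suml beta_moment_sum mulr_sumr horner_sum /=.
apply: eq_bigr => k _; rewrite [X in beta_moment _ X]mulr_sumr beta_moment_sum.
rewrite mulr_sumr horner_sum /=.
apply: eq_bigr => l _; rewrite -scalerAl -scalerAr scalerA beta_momentZ hornerZ.
rewrite mulrCA; congr (_ * _).
set Y := v%:P + _.
(* Writing y - v in powers of y leaves only powers of Y to be integrated. *)
have -> : (1 - v) *: 'X = - v%:P + Y by rewrite /Y addKr.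
rewrite exprDn mulr_suml beta_moment_sum mulr_sumr horner_sum /=.
apply: eq_bigr => i _.
have -> : (- v%:P) ^+ (k - i) * Y ^+ i *+ 'C(k, i) * Y ^+ l =
          ('C(k, i)%:R * (- v) ^+ (k - i)) *: Y ^+ (i + l).
  rewrite mulrnAl -mulrA -exprD -polyCN -rmorphXn /= mul_polyC.
  by rewrite -scalerA scaler_nat.
rewrite beta_momentZ mulrCA beta_moment1_affineXn !hornerE /=.
have -> : (k + l).+1 = (k - i + (i + l).+1)%N.
  by rewrite addnS addnA subnK // -ltnS.
rewrite exprD [in RHS](exprNn v); set c := 'C(k, i)%:R; ring.
Qed.

(** Exchange of the order of integration for v^(b - 1) p(y - v) g(y) on the
triangle 0 < v < y < 1.  For p = X^k and g = X^l each binomial term gives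
1 / (b + k - i) - 1 / (b + k + l + 1) over i + l + 1, which is the product of
the two fractions; the factor 1 / (b + k + l + 1) is common to all terms and
what remains is the binomial expansion of the moment of (1 - X)^k. *)
Lemma beta_moment_xcorr b p g : 0 < b ->
  beta_moment b (xcorr_poly p g) = beta_moment b ('X * abel_poly b p * g).
Proof.
move=> b0.
rewrite /abel_poly mulr_sumr mulr_suml !beta_moment_sum /=.
apply: eq_bigr => k _; rewrite [in RHS](poly_sumXn g).
rewrite [X in _ = beta_moment _ X]mulr_sumr !beta_moment_sum /=; apply: eq_bigr => l _.
rewrite -!scalerAr -scalerAl scalerA -exprS -exprD !beta_momentZ beta_momentXn.
rewrite -!mulrA [RHS]mulrCA; congr (_ * (_ * _)).
have nz m : b + m%:R != 0 by rewrite gt_eqF// ltr_wpDr.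
have -> : (1 - 'X) ^+ k = (- 'X + 1) ^+ k :> {poly R} by rewrite addrC.
rewrite /xcorr_monom exprDn !beta_moment_sum /= mulr_suml; apply: eq_bigr => i _.
rewrite beta_momentZ beta_momentB !beta_momentXn expr1n mulr1 beta_momentMn.
have -> : (- 'X) ^+ (k - i) = (- 1) ^+ (k - i) *: 'X^(k - i) :> {poly R}.
  by rewrite -scaleN1r exprZn.
rewrite beta_momentZ beta_momentXn.
have -> : b + (k + l).+1%:R = (b + (k - i)%:R) + (i + l).+1%:R.
  by rewrite -addrA -natrD addnS addnA subnK // -ltnS.
have nz' : b + (k - i)%:R + (i + l).+1%:R != 0 by rewrite -addrA -natrD nz.
have := nz (k - i)%N; have : (i + l).+1%:R != 0 :> R by rewrite pnatr_eq0.
move: nz'; rewrite -[_ / _ *+ 'C(k, i)]mulr_natl.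
set c := 'C(k, i)%:R; set u := (k - i)%:R; set w := _.+1%:R => ? ? ?.
by clearbody c u w; field; apply/and3P.
Qed.

(** Product rule: (b G + X G') q = (b (G q) + X (G q)') - X G q'. *)
Lemma beta_moment_by_parts b p q : 0 < b ->
  beta_moment b ((b *: abel_poly b p + 'X * (abel_poly b p)^`()) * q) =
  q.[1] * beta_moment b (p \Po (1 - 'X)) - beta_moment b (xcorr_poly p q^`()).
Proof.
move=> b0; rewrite beta_moment_xcorr//; set G := abel_poly b p.
have -> : (b *: G + 'X * G^`()) * q =
          (b *: (G * q) + 'X * (G * q)^`()) - 'X * G * q^`().
  by rewrite derivM -!mul_polyC; ring.
by rewrite beta_momentB beta_moment_euler// hornerM abel_polyE scale1r mulrC.
Qed.

(** Integrating a bivariate polynomial in one variable leaves a polynomial in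
the other. *)
Lemma beta_moment_param b (B : {poly {poly R}}) :
  exists r : {poly R}, forall y, beta_moment b (map_poly (horner_eval y) B) = r.[y].
Proof.
exists (\sum_(m < size B) (b + m%:R)^-1 *: B`_m) => y.
rewrite (beta_moment_widen _ _ _ (size_poly _ _)) horner_sum.
by apply: eq_bigr => m _; rewrite coef_map hornerZ mulrC.
Qed.

End BetaMoment.

(** * Integrals of polynomials against endpoint singularities *)

Section ImproperIntegrals.
Context {R : realType}.
Notation mu := (@lebesgue_measure R).

(** The integrand may be unbounded at both ends.  The theorem for continuous
functions on the compact intervals [a + e_n, b - e_n], with e_n decreasing to
0, passes to the limit by monotone convergence on the left and by the
one-sided continuity of the primitive at a and b on the right. *)
Lemma ge0_FTC2_oo (f F : R -> R) (a b : R) : a < b ->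
  {in `]a, b[, forall x, 0 <= f x} -> {in `]a, b[, continuous f} ->
  derivable_oo_LRcontinuous F a b -> {in `]a, b[, F^`()%classic =1 f} ->
  (\int[mu]_(x in `]a, b[) (f x)%:E = (F b - F a)%:E)%E.
Proof.
move=> ab f0 cf [dF cFa cFb] F'f.
(* The denominator starts at 3 so that already a + e 0 < b - e 0. *)
pose e (n : nat) : R := (b - a) / n.+3%:R.
have e0 n : 0 < e n by rewrite divr_gt0 ?subr_gt0.
have e_lt n : a + e n < b - e n.
  have : e n < (b - a) / 2 by rewrite ltr_pM2l ?subr_gt0// ltf_pV2 ?posrE// ltr_nat.
  lra.
have e_cvg : e n @[n --> \oo] --> 0.
  rewrite -(mulr0 (b - a)); apply: cvgMr.
  apply/gtr0_cvgV0; first by near=> n.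
  have := @cvgr_idn R; rewrite -(cvg_shiftn 3).
  by under eq_fun do rewrite addn3.
pose D n : set R := [set` `[a + e n, b - e n]].
have subD n : D n `<=` `]a, b[.
  move=> x; rewrite /D /= !in_itv/= => /andP[x1 x2].
  by rewrite (lt_le_trans _ x1) ?ltrDl//= (le_lt_trans x2)// gtrDl oppr_lt0.
have ndD : nondecreasing_seq D.
  move=> m n mn; apply/subsetPset => x; rewrite /D /= !in_itv/= => /andP[x1 x2].
  have emn : e n <= e m.
    by rewrite ler_pM2l ?subr_gt0// lef_pV2 ?posrE// ler_nat !ltnS.
  by rewrite (le_trans _ x1) ?lerD2l//= (le_trans x2)// lerD2l lerN2.
have UD : \bigcup_n D n = [set` `]a, b[].
  apply/seteqP; split=> [x [n _]|x]; first exact: subD.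
  rewrite /= in_itv/= => /andP[ax xb].
  have : \forall n \near \oo, e n < Num.min (x - a) (b - x).
    by apply: (cvgr_lt _ e_cvg); rewrite lt_min !subr_gt0 ax.
  case=> N _ /(_ N (leqnn N)) /=; rewrite lt_min => /andP[eN1 eN2].
  by exists N => //; rewrite /D /= in_itv/=; apply/andP; split; lra.
have mf : measurable_fun `]a, b[ f.
  apply: measurable_realfun.open_continuous_measurable_fun => // x.
  by rewrite inE; exact: cf.
have intD n : (\int[mu]_(x in D n) (f x)%:E = (F (b - e n) - F (a + e n))%:E)%E.
  have inD x : x \in `[a + e n, b - e n] -> x \in `]a, b[.
    by move=> xD; have := @subD n x xD.
  have dFn : derivable_oo_LRcontinuous F (a + e n) (b - e n).
    have /(continuous_within_itvP _ (e_lt n))[_ ? ?] :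
        {within `[a + e n, b - e n], continuous F}.
      by apply: derivable_within_continuous => x /inD; exact: dF.
    by split=> // x /subset_itv_oo_cc /inD; exact: dF.
  rewrite (continuous_FTC2 (e_lt n) _ dFn)//.
    apply: continuous_in_subspaceT => x; rewrite inE => /inD; exact: cf.
  by move=> x /subset_itv_oo_cc /inD; exact: F'f.
have lim1 : (\int[mu]_(x in D n) (f x)%:E @[n --> \oo] -->
             \int[mu]_(x in `]a, b[) (f x)%:E)%E.
  rewrite -UD; apply: ge0_nondecreasing_set_cvg_integral => //.
  - by move=> n; exact: measurable_itv.
  - by move=> n; apply/measurable_EFinP; exact: measurable_funS (subD n) mf.
  - by move=> n x /subD xab; rewrite lee_fin f0.
apply: (cvg_unique _ lim1) => //=.
under eq_cvg do rewrite intD.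
apply: cvg_EFin; first exact: nearW.
apply: cvgB.
- move/cvg_at_leftP : cFb; apply; split.
  by move=> n; rewrite gtrDl oppr_lt0.
  by rewrite -[X in _ --> X]subr0; apply: cvgB => //; exact: cvg_cst.
- move/cvg_at_rightP : cFa; apply; split.
  by move=> n; rewrite ltrDl.
  by rewrite -[X in _ --> X]addr0; apply: cvgD => //; exact: cvg_cst.
Unshelve. all: by end_near. Qed.

Lemma itv_kernel_left (a b c : R) : 0 < c -> a < b ->
  (\int[mu]_(x in `]a, b[) ((x - a) `^ (c - 1))%:E = ((b - a) `^ c / c)%:E)%E.
Proof.
move=> c0 ab; pose F x := (x - a) `^ c / c.
have dF x : x \in `]a, +oo[ -> is_derive x 1 F ((x - a) `^ (c - 1)).
  rewrite in_itv/= andbT -subr_gt0 => xa.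
  have dp := is_derive1_powR c xa.
  have ds : is_derive x (1 : R) (fun y : R => y - a) 1 by apply: is_derive_shift.
  have := is_deriveZ c^-1
    (@is_derive1_comp R (fun y => y `^ c) (fun y => y - a) _ _ _ dp ds).
  rewrite mulr1 [_ *: _]mulKf ?gt_eqF//.
  rewrite (_ : _ \*: _ = F)//.
  by apply/funext => y; rewrite /F /= [_ *: _]mulrC.
rewrite (@ge0_FTC2_oo _ F)//.
- by congr (_%:E); rewrite /F subrr powR0 ?gt_eqF// mul0r subr0.
- by move=> x _; exact: powR_ge0.
- move=> x; rewrite in_itv/= => /andP[ax _]; rewrite -subr_gt0 in ax.
  apply: differentiable_continuous; apply/derivable1_diffP.
  have := @is_derive1_comp R (fun y => y `^ (c - 1)) (fun y => y - a)
    _ _ _ (is_derive1_powR (c - 1) ax) (is_derive_shift x 1 (- a)).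
  by case.
- split.
  + by move=> x; rewrite in_itv/= => /andP[ax _]; case: (dF x); rewrite ?in_itv/= ?ax.
  + rewrite [F a](_ : _ = 0); last by rewrite /F subrr powR0 ?gt_eqF// mul0r.
    rewrite -[X in _ --> X](mul0r c^-1); apply: cvgMl.
    apply: (@increasing_cvg_at_right_comp R (fun x => x - a)
      (fun y => y `^ c) a (BLeft b)) => //.
    * by move=> x y _ _; rewrite ltrD2r.
    * by apply: cvg_at_right_filter; apply: cvgB; [exact: cvg_id|exact: cvg_cst].
    * by rewrite subrr; exact: powR_cvg0.
  + apply: cvg_at_left_filter.
    apply: differentiable_continuous; apply/derivable1_diffP.
    by case: (dF b); rewrite ?in_itv/= ?ab.
- move=> x; rewrite in_itv/= => /andP[ax _]; rewrite derive1E.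
  by have := dF x; rewrite in_itv/= ax => /(_ isT) /@derive_val.
Qed.

Lemma itv_kernel_right (a b c : R) : 0 < c -> a < b ->
  (\int[mu]_(x in `]a, b[) ((b - x) `^ (c - 1))%:E = ((b - a) `^ c / c)%:E)%E.
Proof.
move=> c0 ab; pose F x := - ((b - x) `^ c / c).
have dr x : is_derive x (1 : R) (fun y : R => b - y) (- 1).
  have := is_deriveB (is_derive_cst b x (1 : R)) (is_derive_id x (1 : R)).
  by rewrite sub0r.
have dF x : x \in `]-oo, b[ -> is_derive x 1 F ((b - x) `^ (c - 1)).
  rewrite in_itv/= -subr_gt0 => xb.
  have := is_deriveZ (- c^-1) (@is_derive1_comp R
    (fun y => y `^ c) (fun y => b - y) _ _ _ (is_derive1_powR c xb) (dr x)).
  rewrite mulrN1 [_ *: _]mulrNN mulKf ?gt_eqF//.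
  rewrite (_ : _ \*: _ = F)//.
  by apply/funext => y; rewrite /F /= [_ *: _]mulNr mulrC.
rewrite (@ge0_FTC2_oo _ F)//.
- by congr (_%:E); rewrite /F subrr powR0 ?gt_eqF// mul0r oppr0 sub0r opprK.
- by move=> x _; exact: powR_ge0.
- move=> x; rewrite in_itv/= => /andP[_ xb]; rewrite -subr_gt0 in xb.
  apply: differentiable_continuous; apply/derivable1_diffP.
  have := @is_derive1_comp R (fun y => y `^ (c - 1)) (fun y => b - y)
    _ _ _ (is_derive1_powR (c - 1) xb) (dr x).
  by case.
- split.
  + by move=> x; rewrite in_itv/= => /andP[_ xb]; case: (dF x); rewrite ?in_itv/= ?xb.
  + apply: cvg_at_right_filter.
    apply: differentiable_continuous; apply/derivable1_diffP.
    by case: (dF a); rewrite ?in_itv/= ?ab.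
  + rewrite [F b](_ : _ = 0); last by rewrite /F subrr powR0 ?gt_eqF// mul0r oppr0.
    rewrite -[X in _ --> X]oppr0; apply: cvgN.
    rewrite -[X in _ --> X](mul0r c^-1); apply: cvgMl.
    apply: (@decreasing_cvg_at_left_comp R (fun x => b - x)
      (fun y => y `^ c) (BRight a) b) => //.
    * by move=> x y _ _; rewrite ltrD2l ltrN2.
    * by apply: cvg_at_left_filter; apply: cvgB; [exact: cvg_cst|exact: cvg_id].
    * by rewrite subrr; exact: powR_cvg0.
- move=> x; rewrite in_itv/= => /andP[_ xb]; rewrite derive1E.
  by have := dF x; rewrite in_itv/= xb => /(_ isT) /@derive_val.
Qed.

(** By linearity the integrals of the pure powers of w suffice: the monomial
w^m raises the exponent from b to b + m.  The hypothesis on these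
powers holds for the distance to either end of an interval of length c. *)
Lemma Rintegral_powR_poly (D : set R) (w : R -> R) (b c : R) (f : {poly R}) :
  measurable D -> measurable_fun D w -> 0 < b -> 0 <= c ->
  (forall x, D x -> 0 < w x) ->
  (forall e, 0 < e ->
    (\int[mu]_(x in D) (w x `^ (e - 1))%:E = (c `^ e / e)%:E)%E) ->
  \int[mu]_(x in D) (w x `^ (b - 1) * f.[w x]) =
  c `^ b * beta_moment b (f \Po (c *: 'X)).
Proof.
move=> mD mw b0 c0 w0 intw.
have bm0 m : 0 < b + m%:R by rewrite ltr_wpDr.
pose h (m : nat) x := w x `^ (b + m%:R - 1).
have ih m : mu.-integrable D (EFin \o h m).
  apply/integrableP; split.
    apply/measurable_EFinP; exact: (measurableT_comp (measurable_powR _) mw).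
  under eq_integral => x _ do rewrite /= ger0_norm ?powR_ge0//.
  by rewrite intw ?ltry.
rewrite comp_polyE beta_moment_sum mulr_sumr.
transitivity (fine (\int[mu]_(x in D) \sum_(m < size f) ((f`_m)%:E * (EFin \o h m) x))%E).
  congr fine; apply: eq_integral => x; rewrite inE => Dx.
  rewrite /comp/=; under eq_bigr do rewrite -EFinM; rewrite sumEFin; congr (_%:E).
  rewrite horner_coef mulr_sumr; apply: eq_bigr => m _.
  rewrite /h (addrAC b) [w x `^ (b - 1 + _)]powRD ?(gt_eqF (w0 _ Dx)) ?implybT//.
  by rewrite powR_mulrn ?(ltW (w0 _ Dx))// mulrCA.
rewrite integral_sum//; last by move=> m; exact: integrableZl.
under eq_bigr do rewrite integralZl// intw// -EFinM.
rewrite sumEFin /=; apply: eq_bigr => m _.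
rewrite exprZn !beta_momentZ beta_momentXn.
have [->|cn0] := eqVneq c 0.
  by rewrite !powR0 ?gt_eqF// !mul0r mulr0.
by rewrite powRD ?cn0 ?implybT// powR_mulrn//; ring.
Qed.

Lemma Rintegral_kernel_left (a b c : R) (f : {poly R}) : 0 < c -> a < b ->
  \int[mu]_(x in `]a, b[) ((x - a) `^ (c - 1) * f.[x]) =
  (b - a) `^ c * beta_moment c (f \Po (a%:P + (b - a) *: 'X)).
Proof.
move=> c0 ab.
have -> : f \Po (a%:P + (b - a) *: 'X) = (f \Po ('X + a%:P)) \Po ((b - a) *: 'X).
  by rewrite -comp_polyA comp_polyD comp_polyX comp_polyC addrC.
rewrite -(@Rintegral_powR_poly `]a, b[ (fun x => x - a))//.
- by apply: eq_Rintegral => x _; rewrite horner_comp !hornerE subrK.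
- by apply: measurable_funB => //; exact: measurable_id.
- by rewrite subr_ge0 ltW.
- by move=> x; rewrite /= in_itv/= subr_gt0 => /andP[].
- by move=> e e0; exact: itv_kernel_left.
Qed.

Lemma Rintegral_kernel_right (a b c : R) (f : {poly R}) : 0 < c -> a < b ->
  \int[mu]_(x in `]a, b[) ((b - x) `^ (c - 1) * f.[x]) =
  (b - a) `^ c * beta_moment c (f \Po (b%:P - (b - a) *: 'X)).
Proof.
move=> c0 ab.
have -> : f \Po (b%:P - (b - a) *: 'X) = (f \Po (b%:P - 'X)) \Po ((b - a) *: 'X).
  by rewrite -comp_polyA comp_polyB comp_polyX comp_polyC.
rewrite -(@Rintegral_powR_poly `]a, b[ (fun x => b - x))//.
- by apply: eq_Rintegral => x _; rewrite horner_comp !hornerE subKr.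
- by apply: measurable_funB => //; exact: measurable_id.
- by rewrite subr_ge0 ltW.
- by move=> x; rewrite /= in_itv/= subr_gt0 => /andP[].
- by move=> e e0; exact: itv_kernel_right.
Qed.

End ImproperIntegrals.

(** * The local matrix entry *)

Section LocalEntry.
Context {R : realType}.
Notation mu := (@lebesgue_measure R).
Implicit Types (p q P Q : {poly R}).

(** Like [pullback], but to [0, 1] instead of [-1, 1], which keeps powers of 2
out of the formulas. *)
Definition unit_pullback (a b : R) p : {poly R} := p \Po (a%:P + (b - a) *: 'X).

(** The substitution s = x - (x - t_(n-1)) u reduces the Abel integral on
(t_(n-1), x) to a moment on [0, 1]. *)
Lemma rho0E (alpha : R) (t : nat -> R) n p x : 0 < alpha ->
  t n.-1 < t n -> t n.-1 < x ->
  rho0 alpha t n p x = (x - t n.-1) `^ alpha / Gamma alpha *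
    (abel_poly alpha (unit_pullback (t n.-1) (t n) p)).[(x - t n.-1) / (t n - t n.-1)].
Proof.
move=> alpha0 tn tx; rewrite abel_polyE /rho0 /omega.
rewrite (_ : unit_pullback _ _ _ \Po _ = p \Po (x%:P - (x - t n.-1) *: 'X)); last first.
  rewrite /unit_pullback -comp_polyA; congr (_ \Po _).
  rewrite comp_polyD comp_polyZ comp_polyC comp_polyX scalerA.
  by rewrite mulrC divfK ?subr_eq0 ?gt_eqF// -!mul_polyC rmorphB /=; ring.
transitivity (\int[mu]_(s in `]t n.-1, x[)
    ((x - s) `^ (alpha - 1) * ((Gamma alpha)^-1 *: p).[s])).
  by apply: eq_Rintegral => s _; rewrite hornerZ mulrA.
by rewrite Rintegral_kernel_right// comp_polyZ beta_momentZ mulrA.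
Qed.

(** Differentiating w^alpha G(w / h), with w the distance to t_(n-1), gives
w^(alpha - 1) (alpha G + X G')(w / h): again an integrable power times a
polynomial. *)
Lemma H0E (alpha : R) (t : nat -> R) n p q : 0 < alpha -> t n.-1 < t n ->
  let G := abel_poly alpha (unit_pullback (t n.-1) (t n) p) in
  H0 alpha t n p q = (t n - t n.-1) `^ alpha / Gamma alpha *
    beta_moment alpha ((alpha *: G + 'X * G^`()) * unit_pullback (t n.-1) (t n) q).
Proof.
move=> alpha0 tn G; set a := t n.-1 in tn G *; set h := t n - a.
have h0 : 0 < h by rewrite subr_gt0.
pose Gh := G \Po (h^-1 *: ('X - a%:P)).
pose F := (Gamma alpha)^-1 *: (alpha *: Gh + ('X - a%:P) * Gh^`()).
have drho x : a < x -> (rho0 alpha t n p)^`()%classic x = (x - a) `^ (alpha - 1) * F.[x].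
  move=> ax; have xa0 : 0 < x - a by rewrite subr_gt0.
  pose r y := (Gamma alpha)^-1 * ((y - a) `^ alpha * Gh.[y]).
  have -> : (rho0 alpha t n p)^`()%classic x = r^`()%classic x.
    rewrite !derive1E; apply: near_eq_derive; near=> y.
    rewrite rho0E//; last by near: y; exact: lt_nbhsr.
    by rewrite /r /Gh horner_comp !hornerE -/a -/h -/G /= [_ / h]mulrC [_ / Gamma _]mulrC.
  have dw := @is_derive1_comp R (fun y => y `^ alpha) (fun y => y - a) _ _ _
    (is_derive1_powR alpha xa0) (is_derive_shift x 1 (- a)).
  have := is_deriveZ (Gamma alpha)^-1 (is_deriveM dw (is_derive_poly Gh x)).
  move=> /@derive_val dr; rewrite derive1E [LHS]dr.
  rewrite /F !hornerE /= /GRing.scale /= -(mulr_powRB1 (ltW xa0) alpha0).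
  by ring.
rewrite /H0 -/a.
transitivity (\int[mu]_(x in `]a, t n[) ((x - a) `^ (alpha - 1) * (F * q).[x])).
  apply: eq_Rintegral => x; rewrite inE/= in_itv/= => /andP[ax _].
  by rewrite drho// hornerM mulrA.
rewrite Rintegral_kernel_left// -/h -mulrA; congr (_ * _).
rewrite -beta_momentZ comp_polyM -/(unit_pullback a (t n) q) scalerAl.
congr (beta_moment _ (_ * _)).
rewrite /F comp_polyZ comp_polyD comp_polyZ comp_polyM comp_polyB comp_polyX comp_polyC.
have lin : (h^-1 *: ('X - a%:P)) \Po (a%:P + h *: 'X) = 'X.
  rewrite comp_polyZ comp_polyB comp_polyX comp_polyC addrC addKr.
  by rewrite scalerA mulVf ?scale1r ?gt_eqF.
rewrite /Gh deriv_comp comp_polyM -!comp_polyA lin !comp_polyXr; congr (_ *: (_ + _)).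
rewrite derivZ derivB derivX derivC subr0 comp_polyZ comp_polyC.
rewrite addrC addKr -!mul_polyC polyC1 mulr1.
have hV : h%:P * h^-1%:P = 1 :> {poly R} by rewrite -polyCM mulfV ?gt_eqF.
by rewrite -[RHS]mul1r -hV; ring.
Unshelve. all: by end_near. Qed.

(** With v and w the images in [0, 1] of y and z, the two arguments in [Phi] are
the images of (1 - v) w and v + (1 - v) w. *)
Lemma PhiE P Q (y : R) :
  let p := P \Po (2 *: 'X - 1) in let q := Q \Po (2 *: 'X - 1) in
  let v := (1 + y) / 2 in
  Phi P Q y = 2^-1 * beta_moment 1
    ((p \Po ((1 - v) *: 'X)) * (q^`() \Po (v%:P + (1 - v) *: 'X))).
Proof.
move=> p q v; rewrite /Phi.
pose F := (P \Po ((2^-1 * (1 - y)) *: (1 + 'X) - 1)) *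
          (Q^`() \Po (1 - (2^-1 * (1 - y)) *: (1 - 'X))).
(* The unweighted integral is the case of exponent 0 of the power weight. *)
transitivity (2^-1 * \int[mu]_(z in `]-1, 1[) ((z - (-1)) `^ (1 - 1) * F.[z])).
  congr (_ * _); apply: eq_Rintegral => z _.
  by rewrite subrr powRr0 mul1r /F hornerM !horner_comp !hornerE.
rewrite Rintegral_kernel_left// ?gtrN//; congr (_ * _).
rewrite opprK powRr1// -beta_momentZ; congr beta_moment.
set c := 2^-1 * (1 - y) in F *.
have cE : 1 - v = c by rewrite /v /c; field.
have vE : v = 1 - c by rewrite -cE subKr.
rewrite cE vE /F /p /q deriv_comp !comp_polyM -!comp_polyA.
have -> : (2 *: 'X - 1)^`() = 2%:P :> {poly R}.
  by rewrite !poly.derivE subr0 alg_polyC.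
rewrite comp_polyC [X in _ = _ * X]mulrC mul_polyC -?scalerAr; congr (_ *: (_ * _)).
- congr (_ \Po _).
  rewrite -!polyC1 !(comp_polyB, comp_polyD, comp_polyZ, comp_polyX, comp_polyC).
  by rewrite -!mul_polyC !rmorphD !rmorphN /= !polyC1; ring.
- congr (_ \Po _).
  rewrite -!polyC1 !(comp_polyB, comp_polyD, comp_polyZ, comp_polyX, comp_polyC).
  by rewrite -!mul_polyC !rmorphD !rmorphN /= !polyC1; ring.
Qed.

Lemma Phi_polynomial P Q : exists r : {poly R}, forall y, Phi P Q y = r.[y].
Proof.
pose u : {poly {poly R}} := (2^-1 *: (1 - 'X))%:P * 'X.
pose w : {poly {poly R}} := (2^-1 *: (1 + 'X))%:P + u.
(* Opaque names, so that [map_comp_poly] sees only the outer composition. *)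
have [p pE] : exists p, p = P \Po (2 *: 'X - 1) by eexists.
have [g gE] : exists g, g = (Q \Po (2 *: 'X - 1))^`() by eexists.
have [r rE] := beta_moment_param 1 ((p^:P \Po u) * (g^:P \Po w)).
exists (2^-1 *: r) => y; rewrite PhiE -pE -gE hornerZ -rE.
have evalC (s : {poly R}) : map_poly (horner_eval y) s^:P = s.
  by apply/polyP => i; rewrite !coef_map /= horner_evalE hornerC.
have uE : map_poly (horner_eval y) u = (1 - (1 + y) / 2) *: 'X.
  rewrite /u rmorphM /= map_polyC map_polyX /= horner_evalE mul_polyC !hornerE.
  by congr (_ *: _); field.
have wE : map_poly (horner_eval y) w = ((1 + y) / 2)%:P + (1 - (1 + y) / 2) *: 'X.
  by rewrite /w rmorphD /= uE map_polyC /= horner_evalE hornerZ !hornerE [2^-1 * _]mulrC.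
by rewrite [map_poly _ (_ * _)]rmorphM /= !map_comp_poly !evalC uE wE.
Qed.

Lemma unit_pullbackE (t : nat -> R) n p :
  unit_pullback (t n.-1) (t n) p = pullback t n p \Po (2 *: 'X - 1).
Proof.
rewrite /unit_pullback /pullback -comp_polyA; congr (_ \Po _).
rewrite /ref_map comp_polyZ comp_polyD !comp_polyM comp_polyB comp_polyD.
rewrite -!polyC1 !(comp_polyX, comp_polyC) polyC1.
rewrite [1 - _](_ : _ = 2 *: (1 - 'X)); last by rewrite -!mul_polyC; ring.
rewrite [1 + (_ - 1)](_ : _ = 2 *: 'X); last by rewrite -!mul_polyC; ring.
rewrite -!scalerAl -scalerDr scalerA mulVf ?pnatr_eq0// scale1r -mul_polyC rmorphB /=.
by ring.
Qed.

Lemma grid_lt (N : nat) (T : R) (t : nat -> R) n :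
  is_grid N T t -> (1 <= n <= N)%N -> t n.-1 < t n.
Proof. by case: n => // n [_ _ tS] /andP[_ nN]; exact: tS. Qed.

End LocalEntry.

Theorem lemma3 (R : realType) (alpha : R) (halpha : 0 < alpha < 1)
    (N : nat) (T : R) (t : nat -> R) (hgrid : is_grid N T t)
    (r : nat -> nat) (hr : forall n, (1 <= n <= N)%N -> (1 <= r n)%N)
    (psi : forall n : nat, (r n).-tuple {poly_(r n) R})
    (hpsi : forall n, (1 <= n <= N)%N -> basis_of fullv (psi n))
    (n : nat) (hn : (1 <= n <= N)%N) (i j : 'I_(r n)) :
  let psi_i : {poly R} := tnth (psi n) i in
  let psi_j : {poly R} := tnth (psi n) j in
  let Psi_i := pullback t n psi_i in
  let Psi_j := pullback t n psi_j in
  let Phi_ij := Phi Psi_j Psi_i in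
  (exists p : {poly R}, forall y : R, Phi_ij y = p.[y]) /\
  H0 alpha t n psi_j psi_i =
    (step t n / 2) `^ alpha / Gamma alpha *
    (Psi_i.[1] * \int[lebesgue_measure]_(sigma in `]-1, 1[)
                    ((1 - sigma) `^ (alpha - 1) * Psi_j.[sigma])
     - \int[lebesgue_measure]_(y in `]-1, 1[)
          ((1 + y) `^ (alpha - 1) * (1 - y) * Phi_ij y)).
Proof.
move=> psi_i psi_j Psi_i Psi_j Phi_ij.
split; first exact: Phi_polynomial.
have /andP[alpha0 _] := halpha.
have tn : t n.-1 < t n by exact: grid_lt hgrid hn.
rewrite H0E// beta_moment_by_parts// !unit_pullbackE -/Psi_i -/Psi_j.
set p := Psi_j \Po (2 *: 'X - 1); set q := Psi_i \Po (2 *: 'X - 1).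
have m11 : -1 < 1 :> R by rewrite gtrN.
rewrite Rintegral_kernel_right//.
(* At the reference point y, (1 - y) Phi(y) is K at v = (1 + y) / 2: the factor
   1 - y = 2 (1 - v) absorbs the 1/2 in Phi. *)
pose K := xcorr_poly p q^`().
have -> : \int[lebesgue_measure]_(y in `]-1, 1[)
    ((1 + y) `^ (alpha - 1) * (1 - y) * Phi_ij y) =
  \int[lebesgue_measure]_(y in `]-1, 1[)
    ((y - (-1)) `^ (alpha - 1) * (K \Po (2^-1 *: (1 + 'X))).[y]).
  apply: eq_Rintegral => y _; rewrite opprK [y + 1]addrC -mulrA; congr (_ * _).
  rewrite horner_comp xcorr_polyE /Phi_ij PhiE -/p -/q.
  have -> : (2^-1 *: (1 + 'X)).[y] = (1 + y) / 2 by rewrite hornerZ !hornerE mulrC.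
  by rewrite mulrA; congr (_ * _); field.
rewrite Rintegral_kernel_left//.
have -> : (K \Po (2^-1 *: (1 + 'X))) \Po ((-1)%:P + (1 - -1) *: 'X) = K.
  rewrite -comp_polyA -[RHS]comp_polyXr; congr (_ \Po _).
  rewrite -!polyC1 !(comp_polyB, comp_polyD, comp_polyZ, comp_polyX, comp_polyC).
  rewrite rmorphN /= addrA addrN add0r scalerA.
  by rewrite opprK mulVf ?scale1r// pnatr_eq0.
have -> : Psi_j \Po (1%:P - (1 - -1) *: 'X) = p \Po (1 - 'X).
  rewrite /p -(comp_polyA Psi_j); congr (_ \Po _).
  rewrite -!polyC1 !(comp_polyB, comp_polyD, comp_polyZ, comp_polyX, comp_polyC).
  by rewrite -!mul_polyC !rmorphD !rmorphN /= !polyC1; ring.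
have -> : q.[1] = Psi_i.[1] by rewrite /q horner_comp !hornerE; congr horner; ring.
have -> : (t n - t n.-1) `^ alpha = (step t n / 2) `^ alpha * (1 - -1) `^ alpha.
  rewrite -powRM; first by rewrite /step; congr (_ `^ _); field.
    by rewrite divr_ge0// subr_ge0 ltW.
  by rewrite opprK.
by rewrite /K; ring.
Qed.
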